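(* Let $n\ge 1$ be an integer and let $k$ be an odd integer with $1\le k\le n$. Let $a>0$ and let $\alpha,\beta\in\mathbb{R}$ satisfy $0>n\beta\ge\alpha$. Then the problem $$c_{n,k}\,r^{1-n}\bigl(r^{n-k}(v'(r))^k\bigr)'+\alpha v(r)+\beta r v'(r)=0,\qquad v(r)>0,\qquad r\in(0,\infty),$$ $$v(0)=a,\qquad v'(0)=0,$$ has a solution in $(0,\infty)$.
   Context: Here $c_{n,k}=\frac1n\binom{n}{k}$, and prime denotes differentiation with respect to $r$. A solution on $(0,R)$, $0<R\le\infty$, of the initial value problem means a function $v\in C^1([0,R))\cap C^2((0,R))$ that is positive, satisfies the differential equation pointwise on $(0,R)$, and satisfies $v(0)=a$, $v'(0)=0$. *)

(* Defs.v *)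
From Stdlib Require Import Reals Arith.
From Coquelicot Require Import Coquelicot.
Open Scope R_scope.

Definition Ico0 (Rad : Rbar) (r : R) : Prop := 0 <= r /\ Rbar_lt r Rad.
Definition Ioo0 (Rad : Rbar) (r : R) : Prop := 0 < r /\ Rbar_lt r Rad.

(* [D_in] takes the limit of the difference quotients relative to [D], so at a
   boundary point of [D] that belongs to [D] (here: 0) it is the one-sided
   derivative; the values of [f] outside [D] play no role. *)
Definition C1_on (D : R -> Prop) (f f' : R -> R) : Prop :=
  (forall x, D x -> D_in f f' D x) /\ continuous_on D f'.

(* [C] alone would be Coquelicot's type of complex numbers. *)
Definition cnk (n k : nat) : R := / INR n * Binomial.C n k.

(* The functions [v'] and [v''] are uniquely determined by [v] on [0,Rad) and
   (0,Rad) respectively.  On (0,Rad) the argument of [Derive] is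
   differentiable, because [v'] is. *)
Definition ivp_solution (n k : nat) (alpha beta a : R) (Rad : Rbar)
    (v : R -> R) : Prop :=
  exists v' v'' : R -> R,
    C1_on (Ico0 Rad) v v' /\
    C1_on (Ioo0 Rad) v' v'' /\
    (forall r, Ioo0 Rad r -> 0 < v r) /\
    (forall r, Ioo0 Rad r ->
       cnk n k * powerRZ r (1 - Z.of_nat n)
         * Derive (fun s => s ^ (n - k) * v' s ^ k) r
       + alpha * v r + beta * r * v' r = 0) /\
    v 0 = a /\ v' 0 = 0.

(* Main.v *)
Require Import Defs.
From Stdlib Require Import Reals Arith Lra Lia.
From Coquelicot Require Import Coquelicot.
Open Scope R_scope.

(** Put [b = - beta > 0], [d = n * beta - alpha >= 0] and [c = cnk n k].  Since
    [- alpha = n * b + d], the equation multiplied by [r ^ (n - 1)] can be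
    integrated once:
      [c (r ^ (n - k) v' ^ k)' = (b r ^ n v)' + d r ^ (n - 1) v].
    Integrating from 0 and dividing by [r ^ n] leaves
      [c (v' / r) ^ k = b v + d A],  where
      [A r = r ^ (- n) * int_0^r s ^ (n - 1) v s ds
           = int_0^1 t ^ (n - 1) v (r t) dt],
    and the right-hand side is at least [a b > 0] as soon as [v >= a].  Taking
    the positive k-th root, the problem becomes the Volterra equation
      [v r = a + int_0^r s ((b v s + d A s) / c) ^ (1 / k) ds]
    ([integral_equation_solvable]).  The k-th root is Lipschitz on half-lines
    [[th, oo)] with [th > 0], so cutting its argument off at [a b] makes the
    integrand globally Lipschitz in [v] without changing the equation for
    functions [v >= a].  Picard iteration then converges on all of the real
    line: with [K] the Lipschitz constant of the integrand, the m-th increment is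
    locally uniformly [O((K r ^ 2) ^ m / m!)] ([picard_step], [volterra_fixpoint]).
    Both integrals are written as weighted means over [[0, 1]], which keeps every function defined and continuous on
    all of R, with no singularity at [r = 0] and no distinction between the
    signs of [r].

    The solution is C1 with [v' r = r w r], where [w] is the k-th root; away
    from 0 the mean [A] is differentiable, hence so is [v']; and differentiating
    [c r ^ (n - k) v' ^ k = r ^ n (b v + d A)] gives back the equation. *)

(** * Weighted means over the unit interval *)

(** For [r <> 0] this is [r ^ (- j - 1) * int_0^r s ^ j * u s ds]; rescaling to
    the unit interval gives it the right value at [r = 0] as well. *)
Definition scaled_mean (j : nat) (u : R -> R) (r : R) : R :=
  RInt (fun t => t ^ j * u (r * t)) 0 1.

Lemma continuous_pow (j : nat) (x : R) : continuous (fun t : R => t ^ j) x.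
Proof.
  apply (ex_derive_continuous (fun t : R => t ^ j)); auto_derive; trivial.
Qed.

Lemma continuous_Rmult (f g : R -> R) (x : R) :
  continuous f x -> continuous g x -> continuous (fun t => f t * g t) x.
Proof. exact (continuous_mult f g x). Qed.

Lemma ex_RInt_scaled_mean (j : nat) (u : R -> R) (r : R) :
  (forall x, continuous u x) -> ex_RInt (fun t => t ^ j * u (r * t)) 0 1.
Proof.
  intros Hu; apply (ex_RInt_continuous (V := R_CompleteNormedModule)).
  intros z _; apply continuous_Rmult; [apply continuous_pow|].
  apply continuous_comp; [|apply Hu].
  apply continuous_Rmult; [apply continuous_const | apply continuous_id].
Qed.

Lemma scaled_mean_RInt (j : nat) (u : R -> R) (r : R) :
  (forall x, continuous u x) ->
  r ^ S j * scaled_mean j u r = RInt (fun s => s ^ j * u s) 0 r.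
Proof.
  intros Hu.
  assert (H := RInt_comp_lin (V := R_CompleteNormedModule)
                 (fun s => s ^ j * u s) r 0 0 1).
  replace (r * 0 + 0) with 0 in H by ring.
  replace (r * 1 + 0) with r in H by ring.
  rewrite <- H.
  - unfold scaled_mean.
    rewrite <- (RInt_scal (V := R_CompleteNormedModule));
      [|apply ex_RInt_scaled_mean, Hu].
    apply RInt_ext; intros t _; unfold scal; simpl; unfold mult; simpl.
    rewrite Rplus_0_r, Rpow_mult_distr; ring.
  - apply (ex_RInt_continuous (V := R_CompleteNormedModule)).
    intros z _; apply continuous_Rmult; [apply continuous_pow | apply Hu].
Qed.

Lemma is_derive_pow_scaled_mean (j : nat) (u : R -> R) (r : R) :
  (forall x, continuous u x) ->
  is_derive (fun s => s ^ S j * scaled_mean j u s) r (r ^ j * u r).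
Proof.
  intros Hu.
  apply is_derive_ext with (fun x => RInt (fun s => s ^ j * u s) 0 x).
  { intros t; symmetry; apply scaled_mean_RInt, Hu. }
  assert (Hc : forall z, continuous (fun s => s ^ j * u s) z).
  { intros z; apply continuous_Rmult; [apply continuous_pow | apply Hu]. }
  apply (is_derive_RInt (fun s => s ^ j * u s) _ 0).
  - apply filter_forall; intros x.
    apply (RInt_correct (V := R_CompleteNormedModule)).
    apply (ex_RInt_continuous (V := R_CompleteNormedModule)); intros z _; apply Hc.
  - apply Hc.
Qed.

Lemma is_derive_scaled_mean (j : nat) (u : R -> R) (r : R) :
  (forall x, continuous u x) -> r <> 0 ->
  is_derive (scaled_mean j u) r ((u r - INR (S j) * scaled_mean j u r) / r).
Proof.
  intros Hu Hr.
  apply is_derive_ext_loc with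
    (fun s => (s ^ S j * scaled_mean j u s) / s ^ S j).
  { assert (He : 0 < Rabs r) by (apply Rabs_pos_lt, Hr).
    exists (mkposreal _ He); intros s Hs.
    assert (s <> 0).
    { intros ->; revert Hs; unfold ball; simpl; unfold AbsRing_ball, abs, minus,
        plus, opp; simpl.
      rewrite Rplus_0_l, Rabs_Ropp; lra. }
    match goal with |- ?a = ?b => change (@eq R a b) end; field; apply pow_nonzero; auto. }
  evar_last.
  - apply is_derive_div.
    + apply is_derive_pow_scaled_mean, Hu.
    + apply is_derive_pow, is_derive_id.
    + apply pow_nonzero, Hr.
  - change (Init.Nat.pred (S j)) with j.
    assert (Hp : r ^ j <> 0) by (apply pow_nonzero, Hr).
    change (@one R_AbsRing) with 1.
    rewrite <- !tech_pow_Rmult, pow_O; field; auto.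
Qed.

Lemma scaled_mean_minus (j : nat) (u w : R -> R) (r : R) :
  (forall x, continuous u x) -> (forall x, continuous w x) ->
  scaled_mean j u r - scaled_mean j w r = scaled_mean j (fun x => u x - w x) r.
Proof.
  intros Hu Hw; unfold scaled_mean.
  etransitivity.
  { symmetry; apply (RInt_minus (V := R_CompleteNormedModule));
      apply ex_RInt_scaled_mean; assumption. }
  apply RInt_ext; intros t _; unfold minus, plus, opp; simpl; ring.
Qed.

(** A bound of order [m] at the origin improves by the factor [1 / (j + m + 1)].
    This gain is what produces the factorials in the Picard iteration. *)
Lemma scaled_mean_bound (j m : nat) (u : R -> R) (r M : R) :
  (forall x, continuous u x) ->
  (forall t, Rabs t <= Rabs r -> Rabs (u t) <= M * Rabs t ^ m) ->
  Rabs (scaled_mean j u r) <= M * Rabs r ^ m / INR (j + m + 1).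
Proof.
  intros Hu HM; unfold scaled_mean.
  assert (Hpow := is_RInt_scal _ _ _ (M * Rabs r ^ m) _ (is_RInt_pow 0 1 (j + m))).
  eapply Rle_trans; [apply abs_RInt_le; [lra | apply ex_RInt_scaled_mean, Hu]|].
  eapply Rle_trans.
  - apply (RInt_le _ (fun t => scal (M * Rabs r ^ m) (t ^ (j + m))) 0 1); [lra| | |].
    + apply ex_RInt_norm with (f := fun t => t ^ j * u (r * t)).
      apply ex_RInt_scaled_mean, Hu.
    + eexists; exact Hpow.
    + intros t [Ht0 Ht1]; unfold scal; simpl; unfold mult; simpl.
      rewrite Rabs_mult, <- RPow_abs, (Rabs_pos_eq t) by lra.
      assert (Hrt : Rabs (r * t) = Rabs r * t)
        by (rewrite Rabs_mult, (Rabs_pos_eq t); lra).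
      assert (Hb : Rabs (u (r * t)) <= M * Rabs (r * t) ^ m).
      { apply HM; rewrite Hrt; rewrite <- (Rmult_1_r (Rabs r)) at 2.
        apply Rmult_le_compat_l; [apply Rabs_pos | lra]. }
      rewrite Hrt, Rpow_mult_distr in Hb.
      rewrite pow_add.
      apply Rle_trans with (t ^ j * (M * (Rabs r ^ m * t ^ m))); [|right; ring].
      apply Rmult_le_compat_l; [apply pow_le; lra | exact Hb].
  - eapply Rle_trans; [right; exact (is_RInt_unique _ _ _ _ Hpow)|].
    unfold scal; simpl; unfold mult; simpl.
    replace (j + m + 1)%nat with (S (j + m)) by lia.
    rewrite pow1.
    change (match (j + m)%nat with 0%nat => 1 | S _ => INR (j + m) + 1 end)
      with (INR (S (j + m))).
    right; field; apply not_0_INR; lia.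
Qed.

Lemma scaled_mean_ge0 (j : nat) (u : R -> R) (r : R) :
  (forall x, continuous u x) -> (forall x, 0 <= u x) -> 0 <= scaled_mean j u r.
Proof.
  intros Hu H0; unfold scaled_mean.
  apply RInt_ge_0; [lra | apply ex_RInt_scaled_mean, Hu|].
  intros t Ht; apply Rmult_le_pos; [apply pow_le; lra | apply H0].
Qed.

Lemma Rabs_scaled_mean_minus_le (j : nat) (u w : R -> R) (r M : R) :
  (forall x, continuous u x) -> (forall x, continuous w x) ->
  (forall t, Rabs t <= Rabs r -> Rabs (u t - w t) <= M) ->
  Rabs (scaled_mean j u r - scaled_mean j w r) <= M.
Proof.
  intros Hu Hw HM; rewrite scaled_mean_minus by assumption.
  assert (0 <= M).
  { eapply Rle_trans; [apply Rabs_pos | apply (HM 0)].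
    rewrite Rabs_R0; apply Rabs_pos. }
  eapply Rle_trans; [apply (scaled_mean_bound j 0 _ r M)|].
  - intros x; apply (continuous_minus u w); auto.
  - intros t Ht; simpl; rewrite Rmult_1_r; auto.
  - simpl; rewrite Rmult_1_r.
    assert (1 <= INR (j + 0 + 1)) by (apply (le_INR 1); lia).
    apply Rle_div_l; [lra|]; nra.
Qed.

(** Away from 0 the mean is differentiable; at 0 its value is the mean of the
    constant [u 0], from which nearby means differ by at most the oscillation of
    [u]. *)
Lemma continuous_scaled_mean (j : nat) (u : R -> R) (r : R) :
  (forall x, continuous u x) -> continuous (scaled_mean j u) r.
Proof.
  intros Hu; destruct (Req_dec r 0) as [->|Hr].
  - apply filterlim_locally; intros eps.
    assert (He : 0 < eps / 2) by (generalize (cond_pos eps); lra).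
    destruct (proj1 (filterlim_locally _ _) (Hu 0) (mkposreal _ He)) as [d Hd].
    exists d; intros s Hs.
    assert (H0 : scaled_mean j u 0 = scaled_mean j (fun _ => u 0) s).
    { unfold scaled_mean; apply RInt_ext; intros t _; rewrite Rmult_0_l; auto. }
    rewrite H0.
    change (Rabs (scaled_mean j u s - scaled_mean j (fun _ => u 0) s) < eps).
    apply Rle_lt_trans with (eps / 2); [|generalize (cond_pos eps); lra].
    apply Rabs_scaled_mean_minus_le; [exact Hu | intros; apply continuous_const|].
    intros t Ht; left; apply Hd.
    change (Rabs (s - 0) < d) in Hs; change (Rabs (t - 0) < d).
    rewrite Rminus_0_r in *; lra.
  - eapply (ex_derive_continuous (scaled_mean j u)); eexists.
    apply is_derive_scaled_mean; assumption.
Qed.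

(** * Picard iteration for causal operators *)

(** Only the values of [u] and [w] on [[-|r|, |r|]] may influence the comparison
    at [r].  This lets a bound that grows like a power of [|t|] pass through
    [F]. *)
Definition causal_lipschitz (K : R) (F : (R -> R) -> R -> R) : Prop :=
  forall (u w : R -> R) (r M : R),
  (forall x, continuous u x) -> (forall x, continuous w x) ->
  (forall t, Rabs t <= Rabs r -> Rabs (u t - w t) <= M) ->
  Rabs (F u r - F w r) <= K * M.

(** The integral operator [a + int_0^r s * F u s ds], since
    [r ^ 2 * scaled_mean 1 f r] is the integral of [s * f s] from 0 to [r]. *)
Definition volterra (a : R) (F : (R -> R) -> R -> R) (u : R -> R) (r : R) : R :=
  a + r ^ 2 * scaled_mean 1 (F u) r.

Lemma continuous_volterra (a : R) (F : (R -> R) -> R -> R) (u : R -> R) (r : R) :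
  (forall x, continuous (F u) x) -> continuous (volterra a F u) r.
Proof.
  intros HF; unfold volterra.
  apply (continuous_plus (fun _ => a)); [apply continuous_const|].
  apply continuous_Rmult; [apply continuous_pow | apply continuous_scaled_mean, HF].
Qed.

Lemma volterra_contract (a K : R) (F : (R -> R) -> R -> R) (u w : R -> R)
    (r M : R) (m : nat) :
  causal_lipschitz K F ->
  (forall x, continuous u x) -> (forall x, continuous w x) ->
  (forall x, continuous (F u) x) -> (forall x, continuous (F w) x) ->
  0 <= M ->
  (forall t, Rabs t <= Rabs r -> Rabs (u t - w t) <= M * Rabs t ^ m) ->
  Rabs (volterra a F u r - volterra a F w r)
    <= K * M * Rabs r ^ (m + 2) / INR (m + 2).
Proof.
  intros HK Hu Hw HFu HFw HM H; unfold volterra.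
  replace (a + r ^ 2 * scaled_mean 1 (F u) r - (a + r ^ 2 * scaled_mean 1 (F w) r))
    with (r ^ 2 * (scaled_mean 1 (F u) r - scaled_mean 1 (F w) r)) by ring.
  rewrite scaled_mean_minus, Rabs_mult by assumption.
  rewrite <- RPow_abs.
  apply Rle_trans with (Rabs r ^ 2 * ((K * M) * Rabs r ^ m / INR (1 + m + 1))).
  - apply Rmult_le_compat_l; [apply pow_le, Rabs_pos|].
    apply scaled_mean_bound.
    + intros x; apply (continuous_minus (F u) (F w)); auto.
    + intros s Hs; rewrite Rmult_assoc.
      apply HK; try assumption; intros t Ht.
      eapply Rle_trans; [apply H; lra|].
      apply Rmult_le_compat_l; [exact HM|].
      apply pow_incr; split; [apply Rabs_pos | exact Ht].
  - replace (1 + m + 1)%nat with (m + 2)%nat by lia.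
    right; rewrite pow_add; field; apply not_0_INR; lia.
Qed.

Fixpoint picard (a : R) (F : (R -> R) -> R -> R) (m : nat) : R -> R :=
  match m with
  | O => fun _ => a
  | S m => volterra a F (picard a F m)
  end.

Definition preserves_continuity (F : (R -> R) -> R -> R) : Prop :=
  forall u, (forall x, continuous u x) -> forall x, continuous (F u) x.

Lemma continuous_picard (a : R) (F : (R -> R) -> R -> R) (m : nat) (x : R) :
  preserves_continuity F -> continuous (picard a F m) x.
Proof.
  intros HF.
  revert x; induction m as [|m IH]; intros x; simpl.
  - apply continuous_const.
  - apply continuous_volterra, HF, IH.
Qed.

(** Each application of the operator raises the order at 0 by two and divides by
    [2 * (m + 1)], so the increments are dominated by the terms of
    [C * exp (K * r ^ 2)].  The constant [C] depends on the ball only through the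
    first increment. *)
Lemma picard_step (a K : R) (F : (R -> R) -> R -> R) (rho C : R) :
  0 <= K -> causal_lipschitz K F -> preserves_continuity F ->
  0 <= C -> (forall t, Rabs t <= rho -> Rabs (picard a F 1 t - a) <= C) ->
  forall (m : nat) (r : R), Rabs r <= rho ->
  Rabs (picard a F (S m) r - picard a F m r)
    <= C * K ^ m / INR (fact m) * Rabs r ^ (2 * m).
Proof.
  intros HK0 HK HF HC H1 m; induction m as [|m IH]; intros r Hr.
  - rewrite Nat.mul_0_r, !pow_O; simpl fact; simpl INR.
    replace (C * 1 / 1 * 1) with C by field; apply (H1 r Hr).
  - assert (Hf : 0 < INR (fact m)) by apply INR_fact_lt_0.
    assert (HM : 0 <= C * K ^ m / INR (fact m)).
    { apply Rdiv_le_0_compat; [|exact Hf].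
      apply Rmult_le_pos; [exact HC | apply pow_le, HK0]. }
    change (picard a F (S (S m))) with (volterra a F (picard a F (S m))).
    change (picard a F (S m) r) with (volterra a F (picard a F m) r).
    eapply Rle_trans.
    + apply (volterra_contract a K F _ _ r (C * K ^ m / INR (fact m)) (2 * m) HK);
        try exact HM; try (intros; apply continuous_picard, HF);
        try (apply HF; intros; apply continuous_picard, HF).
      intros t Ht; apply IH; apply Rle_trans with (Rabs r); assumption.
    + replace (2 * S m)%nat with (2 * m + 2)%nat by lia.
      set (P := Rabs r ^ (2 * m + 2)).
      assert (HP : 0 <= P) by (apply pow_le, Rabs_pos).
      rewrite fact_simpl, mult_INR.
      assert (Hm : 0 < INR (S m)) by (apply (lt_INR 0); lia).
      replace (INR (2 * m + 2)) with (2 * INR (S m))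
        by (rewrite S_INR, plus_INR, mult_INR; simpl; ring).
      assert (Hq : 0 <= C * K ^ S m / (INR (S m) * INR (fact m)) * P).
      { apply Rmult_le_pos; [|exact HP].
        apply Rdiv_le_0_compat; [|apply Rmult_lt_0_compat; assumption].
        apply Rmult_le_pos; [exact HC | apply pow_le, HK0]. }
      apply Rle_trans with (C * K ^ S m / (INR (S m) * INR (fact m)) * P / 2); [|lra].
      right; rewrite <- (tech_pow_Rmult K); field; lra.
Qed.

Lemma CVN_R_picard (a K : R) (F : (R -> R) -> R -> R) :
  0 <= K -> causal_lipschitz K F -> preserves_continuity F ->
  CVN_R (fun m r => picard a F (S m) r - picard a F m r).
Proof.
  intros HK0 HK HF rho.
  assert (Hcont : forall x, - rho <= x <= rho ->
    continuous (fun t => picard a F 1 t - a) x).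
  { intros x _; apply (continuous_minus (picard a F 1) (fun _ => a));
      [apply continuous_picard, HF | apply continuous_const]. }
  destruct (bounded_continuity (fun t => picard a F 1 t - a) (- rho) rho Hcont)
    as [C HC].
  assert (HC' : forall t, Rabs t <= rho -> Rabs (picard a F 1 t - a) <= C).
  { intros t Ht; left; apply HC; apply Rabs_le_between in Ht; exact Ht. }
  assert (Hrho := cond_pos rho).
  assert (HC0 : 0 <= C).
  { eapply Rle_trans; [apply Rabs_pos | apply (HC' 0)].
    rewrite Rabs_R0; lra. }
  exists (fun m => C * (/ INR (fact m) * (K * rho ^ 2) ^ m)), (C * exp (K * rho ^ 2)).
  split.
  - assert (He := is_exp_Reals (K * rho ^ 2)).
    apply is_pseries_Reals in He.
    intros eps Heps.
    assert (Hs := is_series_Reals (fun m => Rabs (C * (/ INR (fact m) * (K * rho ^ 2) ^ m)))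
                    (C * exp (K * rho ^ 2))).
    apply (proj1 Hs); [|exact Heps].
    apply is_series_ext with (fun m => C * (/ INR (fact m) * (K * rho ^ 2) ^ m)).
    + intros m; symmetry; apply Rabs_pos_eq.
      apply Rmult_le_pos; [exact HC0|]; apply Rmult_le_pos.
      * left; apply Rinv_0_lt_compat, INR_fact_lt_0.
      * apply pow_le, Rmult_le_pos; [exact HK0 | apply pow2_ge_0].
    + apply (is_series_scal (V := R_NormedModule) C
               (fun m => / INR (fact m) * (K * rho ^ 2) ^ m)).
      apply is_series_Reals; exact He.
  - intros m y Hy; unfold Boule in Hy; rewrite Rminus_0_r in Hy.
    eapply Rle_trans; [apply (picard_step a K F rho C HK0 HK HF HC0 HC' m y); lra|].
    rewrite Rpow_mult_distr, <- pow_mult.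
    assert (Hf : 0 < INR (fact m)) by apply INR_fact_lt_0.
    apply Rle_trans with (C * K ^ m / INR (fact m) * rho ^ (2 * m));
      [|right; field; lra].
    apply Rmult_le_compat_l.
    + apply Rdiv_le_0_compat; [|exact Hf].
      apply Rmult_le_pos; [exact HC0 | apply pow_le, HK0].
    + apply pow_incr; split; [apply Rabs_pos | lra].
Qed.

(** The series of increments converges normally on every ball, so its sum [v] is
    continuous.  As the iterates approach [v] uniformly on [[-|r|, |r|]], so do
    their images, and passing to the limit in the recursion shows that [v] is
    fixed. *)
Lemma volterra_fixpoint (a K : R) (F : (R -> R) -> R -> R) :
  0 <= K -> causal_lipschitz K F -> preserves_continuity F ->
  exists v : R -> R, (forall x, continuous v x) /\ forall r, v r = volterra a F v r.
Proof.
  intros HK0 HK HF.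
  set (fn := fun m r => picard a F (S m) r - picard a F m r).
  assert (HN : CVN_R fn) by exact (CVN_R_picard a K F HK0 HK HF).
  set (cv := CVN_R_CVS fn HN).
  set (v := fun r => a + SFL fn cv r).
  assert (HSP : forall N r, picard a F (S N) r = a + SP fn N r).
  { intros N r; unfold SP; induction N as [|N IH]; simpl sum_f_R0.
    - unfold fn; simpl picard; ring.
    - rewrite <- Rplus_assoc, <- IH; unfold fn; simpl picard; ring. }
  assert (Hv : forall x, continuous v x).
  { intros x; apply (continuous_plus (fun _ => a)); [apply continuous_const|].
    apply continuity_pt_filterlim, SFL_continuity; [exact HN|].
    intros m y; apply continuity_pt_filterlim.
    apply (continuous_minus (picard a F (S m)) (picard a F m));
      apply continuous_picard, HF. }
  exists v; split; [exact Hv|]; intros r.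
  apply Rminus_diag_uniq, cond_eq; intros eps Heps.
  rewrite Rminus_0_r.
  (* Both [v r - picard (N + 2) r] and the difference of the images are
     controlled by [d]; their sum [d + K * d * r ^ 2 / 2] is below [eps]. *)
  set (d := eps / (2 + K * Rabs r ^ 2)).
  assert (Hden : 0 <= K * Rabs r ^ 2)
    by (apply Rmult_le_pos; [exact HK0 | apply pow_le, Rabs_pos]).
  assert (Hd : 0 < d) by (apply Rdiv_lt_0_compat; lra).
  assert (Hrho : 0 < Rabs r + 1) by (generalize (Rabs_pos r); lra).
  destruct (CVN_CVU fn cv (mkposreal _ Hrho) (HN _) d Hd) as [N HNN].
  assert (Hclose : forall m t, (N <= m)%nat -> Rabs t <= Rabs r ->
            Rabs (v t - picard a F (S m) t) <= d).
  { intros m t Hm Ht; rewrite HSP; unfold v.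
    replace (a + SFL fn cv t - (a + SP fn m t)) with (SFL fn cv t - SP fn m t) by ring.
    left; apply HNN; [exact Hm|].
    unfold Boule; simpl; rewrite Rminus_0_r; lra. }
  replace (v r - volterra a F v r)
    with ((v r - picard a F (S (S N)) r)
          - (volterra a F v r - volterra a F (picard a F (S N)) r))
    by (simpl picard; ring).
  assert (H1 := Hclose (S N) r (Nat.le_succ_diag_r N) (Rle_refl _)).
  assert (H2 : Rabs (volterra a F v r - volterra a F (picard a F (S N)) r)
               <= K * d * Rabs r ^ (0 + 2) / INR (0 + 2)).
  { apply (volterra_contract a K F v (picard a F (S N)) r d 0 HK); try assumption;
      try (intros; apply continuous_picard, HF);
      try (apply HF; try assumption; intros; apply continuous_picard, HF).
    - left; exact Hd.
    - intros t Ht; simpl; rewrite Rmult_1_r; apply Hclose; [lia | exact Ht]. }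
  apply Rle_lt_trans with (1 := Rabs_triang _ _); rewrite Rabs_Ropp.
  simpl (0 + 2)%nat in H2; simpl INR in H2.
  assert (Hdd : d * (2 + K * Rabs r ^ 2) = eps) by (unfold d; field; lra).
  nra.
Qed.

(** * The root nonlinearity *)

Lemma is_derive_Rpower (p x : R) :
  0 < x -> is_derive (fun y => Rpower y p) x (p * Rpower x (p - 1)).
Proof. intros Hx; apply is_derive_Reals, derivable_pt_lim_power, Hx. Qed.

Lemma continuous_Rpower (p x : R) : 0 < x -> continuous (fun y => Rpower y p) x.
Proof.
  intros Hx; apply (ex_derive_continuous (fun y => Rpower y p)); eexists.
  apply is_derive_Rpower, Hx.
Qed.

(** For [p <= 1] the derivative [p * z ^ (p - 1)] decreases, so its value at the
    left end [th] serves as Lipschitz constant. *)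
Lemma Rpower_lipschitz (p th x y : R) :
  0 < p <= 1 -> 0 < th -> th <= x -> th <= y ->
  Rabs (Rpower x p - Rpower y p) <= p * Rpower th (p - 1) * Rabs (x - y).
Proof.
  intros Hp Hth Hx Hy.
  assert (Hmin : th <= Rmin y x) by (apply Rmin_glb; assumption).
  destruct (MVT_gen (fun z => Rpower z p) y x (fun z => p * Rpower z (p - 1)))
    as [z [Hz Heq]].
  - intros z Hz; apply is_derive_Rpower; lra.
  - intros z Hz; apply continuity_pt_filterlim, continuous_Rpower; lra.
  - rewrite Heq, Rabs_mult.
    apply Rmult_le_compat_r; [apply Rabs_pos|].
    rewrite Rabs_pos_eq;
      [|apply Rmult_le_pos; [lra | left; apply exp_pos]].
    apply Rmult_le_compat_l; [lra|].
    replace (p - 1) with (- (1 - p)) by ring; rewrite !Rpower_Ropp.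
    apply Rinv_le_contravar; [apply exp_pos|].
    apply Rle_Rpower_l; lra.
Qed.

Lemma Rpower_inv_pow (k : nat) (x : R) :
  (1 <= k)%nat -> 0 < x -> Rpower x (/ INR k) ^ k = x.
Proof.
  intros Hk Hx; assert (0 < INR k) by (apply (lt_INR 0); lia).
  rewrite <- Rpower_pow by apply exp_pos.
  rewrite Rpower_mult, Rinv_l by lra; apply Rpower_1, Hx.
Qed.

Lemma Rmax_l_lipschitz (th x y : R) : Rabs (Rmax x th - Rmax y th) <= Rabs (x - y).
Proof.
  unfold Rmax; destruct (Rle_dec x th), (Rle_dec y th);
    unfold Rabs; repeat destruct Rcase_abs; lra.
Qed.

Lemma lipschitz_continuous (L : R) (f : R -> R) (x : R) :
  0 <= L -> (forall y z, Rabs (f y - f z) <= L * Rabs (y - z)) -> continuous f x.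
Proof.
  intros HL Hf; apply filterlim_locally; intros eps.
  assert (He : 0 < eps / (L + 1)).
  { apply Rdiv_lt_0_compat; [apply cond_pos | lra]. }
  exists (mkposreal _ He); intros y Hy.
  change (Rabs (y - x) < eps / (L + 1)) in Hy; change (Rabs (f y - f x) < eps).
  apply Rle_lt_trans with (1 := Hf y x).
  assert (H : Rabs (y - x) * (L + 1) < eps) by (apply Rlt_div_r; lra).
  generalize (Rabs_pos (y - x)); nra.
Qed.

(** * The integral equation *)

(** With [j = n - 1], [r ^ n * flux b d j u r] is the once-integrated right-hand
    side [b * r ^ n * u r + d * int_0^r s ^ (n - 1) * u s ds]. *)
Definition flux (b d : R) (j : nat) (u : R -> R) (r : R) : R :=
  b * u r + d * scaled_mean j u r.

(** The value of [v' / r] determined by the flux [s], with [s] cut off below at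
    [th] to stay away from the point where the root is not Lipschitz. *)
Definition slope (c th : R) (k : nat) (s : R) : R :=
  Rpower (Rmax s th / c) (/ INR k).

Lemma inv_INR_unit (k : nat) : (1 <= k)%nat -> 0 < / INR k <= 1.
Proof.
  intros Hk; assert (1 <= INR k) by (apply (le_INR 1), Hk); split.
  - apply Rinv_0_lt_compat; lra.
  - rewrite <- Rinv_1; apply Rinv_le_contravar; lra.
Qed.

Lemma slope_lipschitz (c th : R) (k : nat) :
  0 < c -> 0 < th -> (1 <= k)%nat ->
  exists L, 0 <= L /\
    forall x y, Rabs (slope c th k x - slope c th k y) <= L * Rabs (x - y).
Proof.
  intros Hc Hth Hk; assert (Hp := inv_INR_unit k Hk).
  set (L := / INR k * Rpower (th / c) (/ INR k - 1)).
  assert (HL : 0 <= L) by (apply Rmult_le_pos; [lra | left; apply exp_pos]).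
  assert (Hic : 0 < / c) by (apply Rinv_0_lt_compat, Hc).
  exists (L * / c); split; [apply Rmult_le_pos; lra|]; intros x y.
  eapply Rle_trans.
  - apply (Rpower_lipschitz (/ INR k) (th / c)); [exact Hp| | |].
    + apply Rdiv_lt_0_compat; assumption.
    + apply Rmult_le_compat_r; [lra | apply Rmax_r].
    + apply Rmult_le_compat_r; [lra | apply Rmax_r].
  - fold L; rewrite Rmult_assoc; apply Rmult_le_compat_l; [exact HL|].
    unfold Rdiv; rewrite <- Rmult_minus_distr_r, Rabs_mult, (Rabs_pos_eq (/ c)) by lra.
    rewrite Rmult_comm; apply Rmult_le_compat_l; [lra | apply Rmax_l_lipschitz].
Qed.

Lemma continuous_flux (b d : R) (j : nat) (u : R -> R) (x : R) :
  (forall y, continuous u y) -> continuous (flux b d j u) x.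
Proof.
  intros Hu; apply (continuous_plus (fun r => b * u r)).
  - apply continuous_Rmult; [apply continuous_const | apply Hu].
  - apply continuous_Rmult; [apply continuous_const | apply continuous_scaled_mean, Hu].
Qed.

Lemma flux_causal_lipschitz (b d : R) (j : nat) :
  0 <= b -> 0 <= d -> causal_lipschitz (b + d) (flux b d j).
Proof.
  intros Hb Hd u w r M Hu Hw HM; unfold flux.
  replace (b * u r + d * scaled_mean j u r - (b * w r + d * scaled_mean j w r))
    with (b * (u r - w r) + d * (scaled_mean j u r - scaled_mean j w r)) by ring.
  apply Rle_trans with (1 := Rabs_triang _ _).
  rewrite !Rabs_mult, (Rabs_pos_eq b), (Rabs_pos_eq d), Rmult_plus_distr_r by assumption.
  apply Rplus_le_compat; apply Rmult_le_compat_l; try assumption.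
  - apply HM, Rle_refl.
  - apply Rabs_scaled_mean_minus_le; assumption.
Qed.

(** The equation is first solved with the cut-off root.  Its positivity gives
    [v >= a], hence [flux >= a * b], and the cut-off at [a * b] is inactive along
    the solution. *)
Lemma integral_equation_solvable (a b c d : R) (j k : nat) :
  0 < a -> 0 < b -> 0 < c -> 0 <= d -> (1 <= k)%nat ->
  exists v : R -> R,
    (forall x, continuous v x) /\ (forall r, a <= v r) /\
    forall r, v r = a + r ^ 2 *
      scaled_mean 1 (fun s => Rpower (flux b d j v s / c) (/ INR k)) r.
Proof.
  intros Ha Hb Hc Hd Hk.
  assert (Hth : 0 < a * b) by (apply Rmult_lt_0_compat; assumption).
  destruct (slope_lipschitz c (a * b) k Hc Hth Hk) as [L [HL Hslope]].
  set (F := fun u s => slope c (a * b) k (flux b d j u s)).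
  assert (HFc : preserves_continuity F).
  { intros u Hu x.
    apply (continuous_comp (flux b d j u) (slope c (a * b) k)); [apply continuous_flux, Hu|].
    apply (lipschitz_continuous L); assumption. }
  assert (HFL : causal_lipschitz (L * (b + d)) F).
  { intros u w r M Hu Hw HM; unfold F.
    apply Rle_trans with (1 := Hslope _ _).
    rewrite Rmult_assoc; apply Rmult_le_compat_l; [exact HL|].
    apply flux_causal_lipschitz; try assumption; lra. }
  destruct (volterra_fixpoint a (L * (b + d)) F) as [v [Hv Hfix]]; try assumption.
  { apply Rmult_le_pos; lra. }
  assert (Hva : forall r, a <= v r).
  { intros r; rewrite Hfix; unfold volterra.
    assert (0 <= r ^ 2 * scaled_mean 1 (F v) r); [|lra].
    apply Rmult_le_pos; [apply pow2_ge_0|].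
    apply scaled_mean_ge0; [apply HFc, Hv|].
    intros x; left; apply exp_pos. }
  exists v; repeat split; [exact Hv | exact Hva|].
  intros r; rewrite (Hfix r) at 1; unfold volterra; do 2 f_equal.
  apply RInt_ext; intros t _; unfold F, slope; rewrite Rmax_left; [reflexivity|].
  unfold flux.
  assert (0 <= scaled_mean j v (r * t)).
  { apply scaled_mean_ge0; [exact Hv | intros x; specialize (Hva x); lra]. }
  specialize (Hva (r * t)); nra.
Qed.

(** * From the integral equation to the initial value problem *)

Lemma cnk_pos (n k : nat) : (1 <= n)%nat -> 0 < cnk n k.
Proof.
  intros Hn; unfold cnk, Binomial.C; apply Rmult_lt_0_compat.
  - apply Rinv_0_lt_compat, (lt_INR 0); lia.
  - apply Rdiv_lt_0_compat; [|apply Rmult_lt_0_compat]; apply INR_fact_lt_0.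
Qed.

Lemma C1_on_of_is_derive (D : R -> Prop) (f f' : R -> R) :
  (forall x, D x -> is_derive f x (f' x)) -> (forall x, D x -> continuous f' x) ->
  C1_on D f f'.
Proof.
  intros Hd Hc; split.
  - intros x Hx; apply D_in_imp with no_cond; [intros; exact I|].
    apply derivable_pt_lim_D_in, is_derive_Reals, Hd, Hx.
  - apply continuous_on_forall; exact Hc.
Qed.

Lemma powerRZ_cancel_pow (n : nat) (r : R) :
  (1 <= n)%nat -> 0 < r -> powerRZ r (1 - Z.of_nat n) * r ^ (n - 1) = 1.
Proof.
  intros Hn Hr; rewrite pow_powerRZ, <- powerRZ_add by lra.
  replace (1 - Z.of_nat n + Z.of_nat (n - 1))%Z with 0%Z by lia; reflexivity.
Qed.

(** Multiplying by [s ^ n] clears the singular weight of the mean, so that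
    differentiation turns the nonlocal part of the flux into a local term. *)
Lemma Derive_weighted_flux (b d : R) (n : nat) (v : R -> R) (r v'r : R) :
  (1 <= n)%nat -> (forall x, continuous v x) -> is_derive v r v'r ->
  Derive (fun s => s ^ n * flux b d (n - 1) v s) r
    = r ^ (n - 1) * ((INR n * b + d) * v r + b * r * v'r).
Proof.
  intros Hn Hv Hd; destruct n as [|j]; [lia|]; rewrite Nat.sub_succ, Nat.sub_0_r.
  apply is_derive_unique.
  apply is_derive_ext with
    (fun s => b * (s ^ S j * v s) + d * (s ^ S j * scaled_mean j v s)).
  { intros t; unfold flux.
    match goal with |- ?x = ?y => change (@eq R x y) end; ring. }
  evar_last.
  - apply (is_derive_plus (K := R_AbsRing) (V := R_NormedModule)
             (fun s => b * (s ^ S j * v s))).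
    + apply is_derive_scal, Derive.is_derive_mult; [|exact Hd].
      apply is_derive_pow, is_derive_id.
    + apply is_derive_scal, is_derive_pow_scaled_mean, Hv.
  - change (Init.Nat.pred (S j)) with j; change (@one R_AbsRing) with 1.
    match goal with |- plus ?x ?y = ?z => change (x + y = z) end.
    cbv beta; rewrite <- tech_pow_Rmult; ring.
Qed.

Theorem lemma2p3 (n k : nat) (a alpha beta : R)
    (hn : (1 <= n)%nat) (hkodd : Nat.Odd k) (hk1 : (1 <= k)%nat)
    (hkn : (k <= n)%nat) (ha : 0 < a)
    (hbeta : 0 > INR n * beta) (halpha : INR n * beta >= alpha) :
  exists v : R -> R, ivp_solution n k alpha beta a p_infty v.
Proof.
  assert (Hn : 0 < INR n) by (apply (lt_INR 0); lia).
  assert (Hb : 0 < - beta) by nra.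
  assert (Hd : 0 <= INR n * beta - alpha) by lra.
  assert (Hc := cnk_pos n k hn).
  set (b := - beta) in *; set (d := INR n * beta - alpha) in *; set (c := cnk n k) in *.
  destruct (integral_equation_solvable a b c d (n - 1) k ha Hb Hc Hd hk1)
    as [v [Hv [Hva Hfix]]].
  set (G := flux b d (n - 1) v).
  set (p := / INR k).
  set (w := fun s => Rpower (G s / c) p).
  assert (HG : forall r, 0 < G r / c).
  { intros r; apply Rdiv_lt_0_compat; [|exact Hc]; unfold G, flux.
    assert (0 <= scaled_mean (n - 1) v r).
    { apply scaled_mean_ge0; [exact Hv | intros x; specialize (Hva x); lra]. }
    specialize (Hva r); nra. }
  assert (HGc : forall x, continuous (fun s => G s / c) x).
  { intros x; apply continuous_Rmult; [apply continuous_flux, Hv | apply continuous_const]. }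
  assert (Hwc : forall x, continuous w x).
  { intros x; apply (continuous_comp (fun s => G s / c) (fun y => Rpower y p));
      [apply HGc | apply continuous_Rpower, HG]. }
  set (v' := fun r => r * w r).
  assert (Hv'c : forall x, continuous v' x).
  { intros x; apply continuous_Rmult; [apply continuous_id | apply Hwc]. }
  assert (Hvd : forall r, is_derive v r (v' r)).
  { intros r; apply is_derive_ext with (fun s => a + s ^ 2 * scaled_mean 1 w s).
    { intros t; symmetry; apply Hfix. }
    evar_last.
    - apply (is_derive_plus (K := R_AbsRing) (V := R_NormedModule) (fun _ => a)).
      + apply is_derive_const.
      + apply is_derive_pow_scaled_mean, Hwc.
    - match goal with |- plus _ ?x = ?y => change (0 + x = y) end; unfold v'; ring. }
  set (G' := fun r => b * v' r
     + d * ((v r - INR (S (n - 1)) * scaled_mean (n - 1) v r) / r)).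
  assert (HGd : forall r, 0 < r -> is_derive (fun s => G s / c) r (G' r / c)).
  { intros r Hr; apply is_derive_ext with (fun s => / c * G s);
      [intros t; apply Rmult_comm|].
    evar_last.
    - apply is_derive_scal.
      apply (is_derive_plus (K := R_AbsRing) (V := R_NormedModule) (fun s => b * v s)).
      + apply is_derive_scal, Hvd.
      + apply is_derive_scal, is_derive_scaled_mean; [exact Hv | lra].
    - apply Rmult_comm. }
  assert (HG'c : forall r, 0 < r -> continuous (fun s => G' s / c) r).
  { intros r Hr; apply continuous_Rmult; [|apply continuous_const].
    apply (continuous_plus (fun s => b * v' s)).
    - apply continuous_Rmult; [apply continuous_const | apply Hv'c].
    - apply continuous_Rmult; [apply continuous_const|].
      apply continuous_Rmult; [|apply continuous_Rinv; lra].
      apply (continuous_minus v); [apply Hv|].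
      apply continuous_Rmult; [apply continuous_const | apply continuous_scaled_mean, Hv]. }
  set (v'' := fun r => w r + r * (G' r / c * (p * Rpower (G r / c) (p - 1)))).
  assert (Hv'd : forall r, 0 < r -> is_derive v' r (v'' r)).
  { intros r Hr; evar_last.
    - apply Derive.is_derive_mult; [apply is_derive_id|].
      apply (is_derive_comp (fun y => Rpower y p) (fun s => G s / c)).
      + apply is_derive_Rpower, HG.
      + apply HGd, Hr.
    - unfold v'', w; change (@one R_AbsRing) with 1; unfold scal; simpl; unfold mult; simpl; ring. }
  exists v, v', v''; split; [|split; [|split; [|split; [|split]]]].
  - apply C1_on_of_is_derive; auto.
  - apply C1_on_of_is_derive; intros r [Hr _]; [apply Hv'd, Hr|].
    apply (continuous_plus w); [apply Hwc|].
    apply continuous_Rmult; [apply continuous_id|].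
    apply continuous_Rmult; [apply HG'c, Hr|].
    apply continuous_Rmult; [apply continuous_const|].
    apply (continuous_comp (fun s => G s / c) (fun y => Rpower y (p - 1)));
      [apply HGc | apply continuous_Rpower, HG].
  - intros r _; specialize (Hva r); lra.
  - intros r [Hr _].
    (* [s ^ (n - k) * (s * w s) ^ k = s ^ n * w s ^ k], and [w ^ k = G / c]. *)
    rewrite (Derive_ext _ (fun s => / c * (s ^ n * G s))).
    + rewrite Derive_scal; unfold G; rewrite (Derive_weighted_flux b d n v r (v' r)); auto.
      transitivity (powerRZ r (1 - Z.of_nat n) * r ^ (n - 1)
          * ((INR n * b + d) * v r + b * r * v' r) + alpha * v r + beta * r * v' r).
      * fold c; field; lra.
      * rewrite powerRZ_cancel_pow by assumption; unfold b, d; ring.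
    + intros s; unfold v', w, p; rewrite Rpow_mult_distr, Rpower_inv_pow by auto.
      replace (s ^ n) with (s ^ (n - k) * s ^ k)
        by (rewrite <- pow_add; f_equal; lia).
      field; lra.
  - rewrite Hfix; ring.
  - unfold v'; ring.
Qed.
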